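(* Let $\mathcal{L}$ be a unimodal signature. The class of $\mathcal{L}$-unimodal algebras is the universal class generated by the complex algebras of all $\mathcal{L}$-unimodal frames, i.e. an $\mathcal{L}$-modal algebra is $\mathcal{L}$-unimodal if and only if it satisfies every universal sentence (in the signature of bounded lattices together with $\mathcal{L}$) that holds in the complex algebras of all $\mathcal{L}$-unimodal frames. The same holds for Heyting (respectively bi-Heyting) $\mathcal{L}$-unimodal algebras, with complex algebras equipped with their Heyting implication (respectively Heyting implication and co-implication).
   Context: Modal symbols: $\Box_{+},\Box_{-},\Diamond_{+},\Diamond_{-}$; a unimodal signature $\mathcal{L}$ is a subset of these. An $\mathcal{L}$-modal algebra is a bounded distributive lattice with one unary operation per symbol in $\mathcal{L}$ satisfying the applicable identities $\Box_{+}(a\wedge b)=\Box_{+}a\wedge\Box_{+}b$, $\Box_{+}\top=\top$; $\Box_{-}(a\vee b)=\Box_{-}a\wedge\Box_{-}b$, $\Box_{-}\bot=\top$; $\Diamond_{+}(a\vee b)=\Diamond_{+}a\vee\Diamond_{+}b$, $\Diamond_{+}\bot=\bot$; $\Diamond_{-}(a\wedge b)=\Diamond_{-}a\vee\Diamond_{-}b$, $\Diamond_{-}\top=\bot$. An $\mathcal{L}$-unimodal algebra is an $\mathcal{L}$-modal algebra satisfying, for all $a,b,c$, each of the following whose two labelling symbols belong to $\mathcal{L}$: $(\Box_{+},\Box_{-})$: $\Box_{-}a\wedge\Box_{+}(a\vee b)\leq\Box_{+}b$; $(\Box_{-},\Box_{+})$: $\Box_{+}a\wedge\Box_{-}(a\wedge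 b)\leq\Box_{-}b$; $(\Diamond_{+},\Diamond_{-})$: $\Diamond_{+}b\leq\Diamond_{+}(a\wedge b)\vee\Diamond_{-}a$; $(\Diamond_{-},\Diamond_{+})$: $\Diamond_{-}b\leq\Diamond_{-}(a\vee b)\vee\Diamond_{+}a$; $(\Box_{+},\Diamond_{-})$: $\Diamond_{-}a\wedge c\leq\Box_{+}a\Rightarrow c\leq\Box_{+}a$; $(\Box_{-},\Diamond_{+})$: $\Diamond_{+}a\wedge c\leq\Box_{-}a\Rightarrow c\leq\Box_{-}a$; $(\Diamond_{+},\Box_{-})$: $\Diamond_{+}a\leq\Box_{-}a\vee c\Rightarrow\Diamond_{+}a\leq c$; $(\Diamond_{-},\Box_{+})$: $\Diamond_{-}a\leq\Box_{+}a\vee c\Rightarrow\Diamond_{-}a\leq c$; $(\Box_{+},\Diamond_{+})$: $\Diamond_{+}b\wedge c\leq\Box_{+}a\Rightarrow\Box_{+}(a\vee b)\wedge c\leq\Box_{+}a$; $(\Box_{-},\Diamond_{-})$: $\Diamond_{-}b\wedge c\leq\Box_{-}a\Rightarrow\Box_{-}(a\wedge b)\wedge c\leq\Box_{-}a$; $(\Diamond_{+},\Box_{+})$: $\Diamond_{+}a\leq\Box_{+}b\vee c\Rightarrow\Diamond_{+}a\leq\Diamond_{+}(a\wedge b)\vee c$; $(\Diamond_{-},\Box_{-})$: $\Diamond_{-}a\leq\Box_{-}b\vee c\Rightarrow\Diamond_{-}a\leq\Diamond_{-}(a\vee b)\vee c$. A (bi-)Heyting $\mathcal{L}$-unimodal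 algebra is an $\mathcal{L}$-unimodal algebra which is also a Heyting algebra (with $\rightarrow$: $a\wedge b\leq c\iff b\leq a\rightarrow c$), resp. also has a co-implication $-$ with $a\leq b\vee c\iff a-b\leq c$. Frames: $x\,(S\circ T)\,z$ iff $xSy$, $yTz$ for some $y$. On a poset $(W,\leq)$, $R$ is a $\Box_{+}$-relation if ${\leq}\circ R\circ{\leq}\subseteq R$, $\Box_{-}$-relation if ${\leq}\circ R\circ{\geq}\subseteq R$, $\Diamond_{+}$-relation if ${\geq}\circ R\circ{\geq}\subseteq R$, $\Diamond_{-}$-relation if ${\geq}\circ R\circ{\leq}\subseteq R$; $\Box_{+}[R]={\leq}\circ R\circ{\leq}$, $\Box_{-}[R]={\leq}\circ R\circ{\geq}$, $\Diamond_{+}[R]={\geq}\circ R\circ{\geq}$, $\Diamond_{-}[R]={\geq}\circ R\circ{\leq}$. An $\mathcal{L}$-modal frame is a poset with a $\Delta_\alpha$-relation $R^{\Delta}_{\alpha}$ for each $\Delta_\alpha\in\mathcal{L}$; it is $\mathcal{L}$-unimodal if some $R$ satisfies $R^{\Delta}_{\alpha}=\Delta_\alpha[R]$ for all $\Delta_\alpha\in\mathcal{L}$. Its complex algebra is the lattice of upsets with $\Box_{+}a=\{u:\forall v\,(uR^{\Box}_{+}v\Rightarrow v\in a)\}$, $\Box_{-}a=\{u:\forall v\,(uR^{\Box}_{-}v\Rightarrow v\notin a)\}$, $\Diamond_{+}a=\{u:\exists v\in a,\ uR^{\Diamond}_{+}v\}$, $\Diamond_{-}a=\{u:\exists v\notin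 a,\ uR^{\Diamond}_{-}v\}$, and, when needed, $a\rightarrow b=\{u:\forall v\geq u\,(v\in a\Rightarrow v\in b)\}$, $a-b=\{u:\exists v\leq u,\ v\in a,\ v\notin b\}$. *)

(* Defs.v *)
From HB Require Import structures.
From mathcomp Require Import all_boot all_order.
From mathcomp Require Import boolp classical_sets.

Set Implicit Arguments.
Unset Strict Implicit.
Unset Printing Implicit Defensive.

Import Order.TTheory.
Export SetOrder.Exports.
Local Open Scope order_scope.

Inductive modsym := BoxP | BoxM | DiaP | DiaM.

(* The extra lattice operations of the similarity type: none, Heyting
   implication, or Heyting implication and co-implication. *)
Inductive expansion := Plain | Heyting | BiHeyting.

Definition has_imp (e : expansion) : bool :=
  if e is Plain then false else true.

Definition has_coimp (e : expansion) : bool :=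
  if e is BiHeyting then true else false.

Definition modal_identities (d : Order.disp_t) (A : tbDistrLatticeType d)
    (s : modsym) (f : A -> A) : Prop :=
  match s with
  | BoxP => (forall a b, f (a `&` b) = f a `&` f b) /\ f \top = \top
  | BoxM => (forall a b, f (a `|` b) = f a `&` f b) /\ f \bot = \top
  | DiaP => (forall a b, f (a `|` b) = f a `|` f b) /\ f \bot = \bot
  | DiaM => (forall a b, f (a `&` b) = f a `|` f b) /\ f \top = \bot
  end.

(* [modalAlgebra L Plain], [modalAlgebra L Heyting] and
   [modalAlgebra L BiHeyting] are respectively the L-modal algebras, the
   Heyting L-modal algebras and the bi-Heyting L-modal algebras.  Operations
   exist only for the symbols that belong to the similarity type. *)
Record modalAlgebra (L : {pred modsym}) (e : expansion) := ModalAlgebra {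
  alg_disp : Order.disp_t;
  alg_sort :> tbDistrLatticeType alg_disp;
  mop : forall s, s \in L -> alg_sort -> alg_sort;
  imp : has_imp e -> alg_sort -> alg_sort -> alg_sort;
  coimp : has_coimp e -> alg_sort -> alg_sort -> alg_sort;
  mopP : forall s (sL : s \in L), modal_identities s (mop sL);
  impP : forall (h : has_imp e) (a b c : alg_sort),
    a `&` b <= c <-> b <= imp h a c;
  coimpP : forall (h : has_coimp e) (a b c : alg_sort),
    a <= b `|` c <-> coimp h a b <= c
}.

Record unimodal (L : {pred modsym}) (e : expansion) (A : modalAlgebra L e) :
    Prop := Unimodal {
  uni_BoxP_BoxM : forall (bp : BoxP \in L) (bm : BoxM \in L) (a b : A),
    mop bm a `&` mop bp (a `|` b) <= mop bp b;
  uni_BoxM_BoxP : forall (bm : BoxM \in L) (bp : BoxP \in L) (a b : A),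
    mop bp a `&` mop bm (a `&` b) <= mop bm b;
  uni_DiaP_DiaM : forall (dp : DiaP \in L) (dm : DiaM \in L) (a b : A),
    mop dp b <= mop dp (a `&` b) `|` mop dm a;
  uni_DiaM_DiaP : forall (dm : DiaM \in L) (dp : DiaP \in L) (a b : A),
    mop dm b <= mop dm (a `|` b) `|` mop dp a;
  uni_BoxP_DiaM : forall (bp : BoxP \in L) (dm : DiaM \in L) (a c : A),
    mop dm a `&` c <= mop bp a -> c <= mop bp a;
  uni_BoxM_DiaP : forall (bm : BoxM \in L) (dp : DiaP \in L) (a c : A),
    mop dp a `&` c <= mop bm a -> c <= mop bm a;
  uni_DiaP_BoxM : forall (dp : DiaP \in L) (bm : BoxM \in L) (a c : A),
    mop dp a <= mop bm a `|` c -> mop dp a <= c;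
  uni_DiaM_BoxP : forall (dm : DiaM \in L) (bp : BoxP \in L) (a c : A),
    mop dm a <= mop bp a `|` c -> mop dm a <= c;
  uni_BoxP_DiaP : forall (bp : BoxP \in L) (dp : DiaP \in L) (a b c : A),
    mop dp b `&` c <= mop bp a -> mop bp (a `|` b) `&` c <= mop bp a;
  uni_BoxM_DiaM : forall (bm : BoxM \in L) (dm : DiaM \in L) (a b c : A),
    mop dm b `&` c <= mop bm a -> mop bm (a `&` b) `&` c <= mop bm a;
  uni_DiaP_BoxP : forall (dp : DiaP \in L) (bp : BoxP \in L) (a b c : A),
    mop dp a <= mop bp b `|` c -> mop dp a <= mop dp (a `&` b) `|` c;
  uni_DiaM_BoxM : forall (dm : DiaM \in L) (bm : BoxM \in L) (a b c : A),
    mop dm a <= mop bm b `|` c -> mop dm a <= mop dm (a `|` b) `|` c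
}.

Section UniversalSentences.
Variables (L : {pred modsym}) (e : expansion).

Inductive term :=
  | Var of nat
  | TTop
  | TBot
  | TMeet of term & term
  | TJoin of term & term
  | TMod s of s \in L & term
  | TImp of has_imp e & term & term
  | TCoimp of has_coimp e & term & term.

Inductive qf_formula :=
  | FEq of term & term
  | FFalse
  | FNot of qf_formula
  | FAnd of qf_formula & qf_formula
  | FOr of qf_formula & qf_formula
  | FImplies of qf_formula & qf_formula.

Variable A : modalAlgebra L e.

Fixpoint eval (v : nat -> A) (t : term) : A :=
  match t with
  | Var n => v n
  | TTop => \top
  | TBot => \bot
  | TMeet t u => eval v t `&` eval v u
  | TJoin t u => eval v t `|` eval v u
  | TMod _ sL t => mop sL (eval v t)
  | TImp h t u => imp h (eval v t) (eval v u)
  | TCoimp h t u => coimp h (eval v t) (eval v u)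
  end.

Fixpoint holds (v : nat -> A) (phi : qf_formula) : Prop :=
  match phi with
  | FEq t u => eval v t = eval v u
  | FFalse => False
  | FNot f => ~ holds v f
  | FAnd f g => holds v f /\ holds v g
  | FOr f g => holds v f \/ holds v g
  | FImplies f g => holds v f -> holds v g
  end.

(* A universal sentence is represented by its quantifier-free matrix, all of
   whose variables are universally quantified. *)
Definition satisfies (phi : qf_formula) : Prop :=
  forall v : nat -> A, holds v phi.

End UniversalSentences.

Section Relations.
Variables (d : Order.disp_t) (W : porderType d).
Implicit Types (R S T : W -> W -> Prop).

Definition rcomp S T : W -> W -> Prop := fun x z => exists2 y, S x y & T y z.

Definition leW : W -> W -> Prop := fun x y => x <= y.
Definition geW : W -> W -> Prop := fun x y => y <= x.

(* Delta_alpha[R] *)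
Definition sym_closure (s : modsym) R : W -> W -> Prop :=
  match s with
  | BoxP => rcomp (rcomp leW R) leW
  | BoxM => rcomp (rcomp leW R) geW
  | DiaP => rcomp (rcomp geW R) geW
  | DiaM => rcomp (rcomp geW R) leW
  end.

Definition sym_relation (s : modsym) R : Prop :=
  forall x y, sym_closure s R x y -> R x y.

End Relations.

Record frame (L : {pred modsym}) := Frame {
  fr_disp : Order.disp_t;
  fr_sort :> porderType fr_disp;
  fr_rel : forall s, s \in L -> fr_sort -> fr_sort -> Prop;
  fr_relP : forall s (sL : s \in L), sym_relation s (fr_rel sL)
}.

Definition unimodal_frame (L : {pred modsym}) (F : frame L) : Prop :=
  exists R : F -> F -> Prop,
    forall s (sL : s \in L) (x y : F),
      fr_rel sL x y <-> sym_closure s R x y.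

Section Upsets.
Variables (d : Order.disp_t) (W : porderType d).

Definition is_upset (a : set W) : Prop := forall x y, x <= y -> a x -> a y.

Definition upset_pred : {pred set W} := [pred a | `[< is_upset a >]].

Record upset := Upset { upset_val :> set W; _ : upset_val \in upset_pred }.

HB.instance Definition _ := [isSub for upset_val].
HB.instance Definition _ := [Choice of upset by <:].

Lemma upsetP (a : upset) : is_upset a.
Proof. by case: a => a /= /asboolP. Qed.

Definition mk_upset (a : set W) (h : is_upset a) : upset :=
  @Upset a (introT (asboolP (is_upset a)) h).

Lemma upset_predI :
  {in upset_pred &, forall a b, (a `&` b)%O \in upset_pred}.
Proof.
move=> a b /asboolP ha /asboolP hb; apply/asboolP => x y xy [ax bx].
by split; [exact: ha ax | exact: hb bx].
Qed.

Lemma upset_predU :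
  {in upset_pred &, forall a b, (a `|` b)%O \in upset_pred}.
Proof.
move=> a b /asboolP ha /asboolP hb; apply/asboolP => x y xy [ax|bx].
  by left; exact: ha ax.
by right; exact: hb bx.
Qed.

Lemma upset_pred0 : (\bot : set W) \in upset_pred.
Proof. by apply/asboolP. Qed.

Lemma upset_predT : (\top : set W) \in upset_pred.
Proof. by apply/asboolP. Qed.

Fact upset_display : Order.disp_t. Proof. exact: Order.Disp tt tt. Qed.

(* The order, meets and joins of upsets are inherited from [set W], i.e. they
   are inclusion, intersection and union. *)
HB.instance Definition _ := Order.isTBLatticeClosed.Build _ _ upset_pred
  upset_predI upset_predU upset_pred0 upset_predT.
HB.instance Definition _ :=
  [SubChoice_isTBSubLattice of upset by <: with upset_display].

Lemma upset_valI (a b : upset) : upset_val (a `&` b) = (a `&` b)%classic.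
Proof. by []. Qed.

Lemma upset_valU (a b : upset) : upset_val (a `|` b) = (a `|` b)%classic.
Proof. by []. Qed.

Lemma upset_val0 : upset_val \bot = set0.
Proof. by []. Qed.

Lemma upset_val1 : upset_val \top = setT.
Proof. by []. Qed.

Lemma upset_leP (a b : upset) : reflect (a `<=` b)%classic (a <= b).
Proof. exact: asboolP. Qed.

Lemma upset_meetUl : @left_distributive upset upset Order.meet Order.join.
Proof. by move=> a b c; apply: val_inj; exact: setIUl. Qed.

HB.instance Definition _ :=
  Order.Lattice_Meet_isDistrLattice.Build upset_display upset upset_meetUl.

Lemma upset_leE (a b : upset) :
  (a <= b) <-> (forall x, upset_val a x -> upset_val b x).
Proof. by split=> /upset_leP. Qed.

Lemma upset_eqE (a b : upset) :
  (forall x, upset_val a x <-> upset_val b x) -> a = b.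
Proof.
by move=> h; apply: le_anti; apply/andP; split; apply/upset_leE => x /h.
Qed.

Lemma upset_meetE (a b : upset) x :
  upset_val (a `&` b) x <-> upset_val a x /\ upset_val b x.
Proof. by rewrite upset_valI. Qed.

Lemma upset_joinE (a b : upset) x :
  upset_val (a `|` b) x <-> upset_val a x \/ upset_val b x.
Proof. by rewrite upset_valU. Qed.

Lemma upset_topE x : upset_val \top x <-> True.
Proof. by rewrite upset_val1. Qed.

Lemma upset_botE x : upset_val \bot x <-> False.
Proof. by rewrite upset_val0. Qed.

Definition sym_op_set (s : modsym) (R : W -> W -> Prop) (a : set W) : set W :=
  match s with
  | BoxP => [set u | forall v, R u v -> a v]%classic
  | BoxM => [set u | forall v, R u v -> ~ a v]%classic
  | DiaP => [set u | exists2 v, a v & R u v]%classic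
  | DiaM => [set u | exists2 v, ~ a v & R u v]%classic
  end.

Lemma sym_op_upset s (R : W -> W -> Prop) (a : set W) :
  sym_relation s R -> is_upset (sym_op_set s R a).
Proof.
case: s => hR x y xy /=.
- by move=> h v yv; apply: h; apply: hR; exists v => //; [exists y|exact: lexx].
- by move=> h v yv; apply: h; apply: hR; exists v => //; [exists y|exact: lexx].
- move=> [v av xv]; exists v => //; apply: hR; exists v; last exact: lexx.
  by exists x.
- move=> [v av xv]; exists v => //; apply: hR; exists v; last exact: lexx.
  by exists x.
Qed.

Definition sym_op s (R : W -> W -> Prop) (hR : sym_relation s R) (a : upset) :
    upset :=
  mk_upset (@sym_op_upset s R a hR).

Lemma sym_opP s (R : W -> W -> Prop) (hR : sym_relation s R) :
  modal_identities s (sym_op hR).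
Proof.
case: s hR => hR; split.
- move=> a b; apply: upset_eqE => x; rewrite upset_meetE /=; split.
    by move=> h; split=> v /h /upset_meetE[].
  by move=> [ha hb] v xv; apply/upset_meetE; split; [exact: ha|exact: hb].
- by apply: upset_eqE => x; rewrite upset_topE /=; split.
- move=> a b; apply: upset_eqE => x; rewrite upset_meetE /=; split.
    by move=> h; split=> v /h hv av; apply: hv; apply/upset_joinE; [left|right].
  by move=> [ha hb] v xv /upset_joinE[]; [exact: ha|exact: hb].
- by apply: upset_eqE => x; rewrite upset_topE /=; split=> // _ v _ /upset_botE.
- move=> a b; apply: upset_eqE => x; rewrite upset_joinE /=; split.
    by move=> [v /upset_joinE[av|bv] xv]; [left|right]; exists v.
  move=> [[v av xv]|[v bv xv]]; exists v => //; apply/upset_joinE.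
    by left.
  by right.
- by apply: upset_eqE => x; rewrite upset_botE /=; split=> // -[v /upset_botE].
- move=> a b; apply: upset_eqE => x; rewrite upset_joinE /=; split.
    move=> [v nab xv].
    have [av|nav] := pselect (upset_val a v); last by left; exists v.
    by right; exists v => // bv; apply: nab; apply/upset_meetE.
  by move=> [[v nv xv]|[v nv xv]]; exists v => // /upset_meetE[].
- apply: upset_eqE => x; rewrite upset_botE /=; split=> // -[v nv _].
  by apply: nv; apply/upset_topE.
Qed.

Definition imp_set (a b : set W) : set W :=
  [set u | forall v, u <= v -> a v -> b v]%classic.

Definition coimp_set (a b : set W) : set W :=
  [set u | exists v, [/\ v <= u, a v & ~ b v]]%classic.

Lemma imp_is_upset a b : is_upset (imp_set a b).
Proof. by move=> x y xy h v yv; apply: h; exact: le_trans yv. Qed.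

Lemma coimp_is_upset a b : is_upset (coimp_set a b).
Proof.
by move=> x y xy [v [vx av bv]]; exists v; split=> //; exact: le_trans xy.
Qed.

Definition upset_imp (a b : upset) : upset := mk_upset (@imp_is_upset a b).

Definition upset_coimp (a b : upset) : upset := mk_upset (@coimp_is_upset a b).

Lemma upset_impP (a b c : upset) : a `&` b <= c <-> b <= upset_imp a c.
Proof.
rewrite !upset_leE; split=> [h x bx v xv av|h x /upset_meetE[ax bx]].
  by apply: h; apply/upset_meetE; split=> //; exact: upsetP bx.
by apply: h bx _ _ ax; exact: lexx.
Qed.

Lemma upset_coimpP (a b c : upset) : a <= b `|` c <-> upset_coimp a b <= c.
Proof.
rewrite !upset_leE; split=> [h x [v [vx av nbv]]|h x ax].
  by have /upset_joinE[//|cv] := h _ av; exact: upsetP cv.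
apply/upset_joinE; have [bx|nbx] := pselect (upset_val b x); first by left.
by right; apply: h; exists x; split=> //; exact: lexx.
Qed.

End Upsets.

Definition complex_algebra (L : {pred modsym}) (F : frame L) (e : expansion) :
    modalAlgebra L e :=
  @ModalAlgebra L e upset_display (upset F)
    (fun s sL => sym_op (@fr_relP L F s sL))
    (fun _ => @upset_imp _ F)
    (fun _ => @upset_coimp _ F)
    (fun s sL => sym_opP (@fr_relP L F s sL))
    (fun _ => @upset_impP _ F)
    (fun _ => @upset_coimpP _ F).

(* Main.v *)
From HB Require Import structures.
Require Import Defs.
From mathcomp Require Import all_boot all_order.
From mathcomp Require Import boolp classical_sets.

(** Universal sentences pass to subalgebras, so it is enough to embed a
    unimodal algebra [A] into the complex algebra of a unimodal frame;
    conversely, the unimodal laws are universal sentences valid in such complex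
    algebras.

    The frame is the spectrum of prime filters of [A] with its canonical
    relations, and the witness of unimodality is the intersection of these
    relations.  Given [P] and [Q] related by the [BoxP]-relation, one needs
    [P'] above [P] and [Q'] below [Q] that are related by all of them at once.
    Take [P'] maximal among the filters above [P] still [BoxP]-related to [Q].
    Then [Q'] has to contain the filter [N] of all [x] such that [x `|` b] is
    mapped by [BoxP] into [P'] for some [b] outside [Q], and the laws labelled
    ([BoxP], _) say that whatever else [Q'] has to contain lies in [N], and that
    whatever it has to avoid can be cancelled from joins belonging to [N].  The
    elements with this cancellation property form an ideal disjoint from [N], so
    the prime filter theorem yields [Q'].

    The laws only use the modalities as maps from a target lattice to a source
    lattice, so replacing either lattice by its order dual permutes the four
    modalities transitively, and the other three cases follow. *)

Set Implicit Arguments.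
Unset Strict Implicit.
Unset Printing Implicit Defensive.

Import Order.TTheory.
Local Open Scope classical_set_scope.
Local Open Scope order_scope.

Section Filters.
Variables (d : Order.disp_t) (A : tbDistrLatticeType d).
Implicit Types (F I P : set A) (a b x y z : A).

Record is_filter F : Prop := IsFilter {
  filterT : F \top;
  filterI : forall a b, F a -> F b -> F (a `&` b);
  filter_le : forall a b, a <= b -> F a -> F b }.

Record is_ideal I : Prop := IsIdeal {
  ideal0 : I \bot;
  idealU : forall a b, I a -> I b -> I (a `|` b);
  ideal_le : forall a b, a <= b -> I b -> I a }.

Definition prime_filter P : Prop := is_filter P /\ is_ideal (~` P)%classic.

Lemma principal_filter a : is_filter [set x | a <= x].
Proof.
split=> [|x y ax ay|x y xy ax] /=; first exact: lex1.
  by rewrite lexI ax.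
exact: le_trans xy.
Qed.

Lemma principal_ideal b : is_ideal [set x | x <= b].
Proof.
split=> [|x y xb yb|x y] /=; first exact: le0x.
  by rewrite leUx xb.
exact: le_trans.
Qed.

Lemma filter_bigcup (T : Type) (C : set T) (G : T -> set A) :
    C !=set0 -> (forall i, C i -> is_filter (G i)) ->
    total_on C (fun i j => G i `<=` G j) ->
  is_filter (\bigcup_(i in C) G i).
Proof.
move=> [i0 Ci0] filG Gtot; split.
- by exists i0 => //; exact: filterT (filG _ Ci0).
- move=> a b [i Ci Ga] [j Cj Gb]; have [Gij|Gji] := Gtot i j Ci Cj.
    by exists j => //; exact: (filterI (filG j Cj) (Gij a Ga) Gb).
  by exists i => //; exact: (filterI (filG i Ci) Ga (Gji b Gb)).
- move=> a b ab [i Ci Ga].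
  by exists i => //; exact: (filter_le (filG i Ci) ab Ga).
Qed.

Lemma filter_adjoin P x :
  is_filter P -> is_filter [set z | exists2 y, P y & x `&` y <= z].
Proof.
move=> filP; split=> [|a b [y Py ya] [z Pz zb]|a b ab [y Py ya]] /=.
- by exists \top; [exact: filterT|exact: lex1].
- exists (y `&` z); first exact: filterI.
  by rewrite lexI (le_trans _ ya) ?(le_trans _ zb) // leI2 ?leIl ?leIr.
- by exists y => //; exact: le_trans ab.
Qed.

Lemma ex_maximal_filter_avoiding F I :
    is_filter F -> (F `<=` ~` I)%classic ->
  exists P, [/\ is_filter P, F `<=` P, (P `<=` ~` I)%classic &
    forall Q, is_filter Q -> P `<=` Q -> (Q `<=` ~` I)%classic -> Q `<=` P].
Proof.
move=> filF FI.
pose good Q := [/\ is_filter Q, F `<=` Q & (Q `<=` ~` I)%classic].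
pose sub (P Q : {Q | good Q}) := `[< sval P `<=` sval Q >].
have goodF : good F by split.
have [|||[P [filP FP PI]] maxP] := @ZL_preorder _ (exist _ F goodF) sub.
- by move=> P; apply/asboolP.
- move=> P Q S /asboolP PQ /asboolP QS.
  by apply/asboolP; exact: subset_trans QS.
- move=> C Ctot; have [C0|noC] := pselect (C !=set0); last first.
    by exists (exist _ F goodF) => Q CQ; case: noC; exists Q.
  have goodC : good (\bigcup_(Q in C) sval Q).
    split.
    + apply: filter_bigcup C0 _ _ => [[Q []] //|Q S CQ CS].
      by have [/asboolP|/asboolP] := Ctot Q S CQ CS; [left|right].
    + have [Q CQ] := C0; have [_ FQ _] := svalP Q.
      by move=> x Fx; exists Q => //; exact: FQ.
    + by move=> x [Q _]; have [_ _] := svalP Q; apply.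
  by exists (exist _ _ goodC) => Q CQ; apply/asboolP => x Qx; exists Q.
exists P; split=> // Q filQ PQ QI.
have goodQ : good Q by split=> //; exact: subset_trans PQ.
by apply/asboolP; apply: (maxP (exist _ Q goodQ)); exact/asboolP.
Qed.

Lemma ex_prime_filter_avoiding F I :
    is_filter F -> is_ideal I -> (F `<=` ~` I)%classic ->
  exists P, [/\ prime_filter P, F `<=` P, (P `<=` ~` I)%classic &
    forall x, ~ P x -> exists2 y, P y & I (x `&` y)].
Proof.
move=> filF idI FI.
have [P [filP FP PI maxP]] := ex_maximal_filter_avoiding filF FI.
have notinP x : ~ P x -> exists2 y, P y & I (x `&` y).
  move=> nPx; apply: contrapT => none; apply: nPx.
  apply: (maxP _ (filter_adjoin x filP)).
  - by move=> z Pz; exists z => //; exact: leIr.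
  - by move=> z [y Py yz] Iz; apply: none; exists y => //; exact: ideal_le Iz.
  - by exists \top; [exact: filterT|rewrite meetx1].
exists P; split=> //; split=> //; split.
- by move=> P0; exact: PI P0 (ideal0 idI).
- move=> a b /notinP[y Py Iay] /notinP[z Pz Ibz] Pab.
  apply: (PI ((a `|` b) `&` (y `&` z))); first by do !apply: filterI => //.
  apply: ideal_le (idealU idI Iay Ibz) => //.
  by rewrite meetUl leU2 ?leI2 ?leIl ?leIr.
- by move=> a b ab nPb Pa; apply: nPb; exact: filter_le ab Pa.
Qed.

End Filters.

Lemma ideal_lower_image (dA dB : Order.disp_t) (A : tbDistrLatticeType dA)
    (B : tbDistrLatticeType dB) (f : B -> A) (I : set B) :
    {homo f : a b / a <= b} -> is_ideal I ->
  is_ideal [set x | exists2 b, I b & x <= f b].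
Proof.
move=> f_le idI; split=> [|x y [a Ia xa] [b Ib yb]|x y xy [b Ib yb]] /=.
- by exists \bot; [exact: ideal0|exact: le0x].
- exists (a `|` b); first exact: idealU.
  by rewrite leUx (le_trans xa) ?(le_trans yb) // f_le ?leUl ?leUr.
- by exists b => //; exact: le_trans yb.
Qed.

Lemma prime_filter_dual (d : Order.disp_t) (A : tbDistrLatticeType d)
    (P : set A) :
  @prime_filter _ A^d P <-> prime_filter (~` P)%classic.
Proof.
rewrite /prime_filter setCK.
by split=> -[[? ? upP] [? ? downP]]; split; split=> // a b;
  by [exact: downP|exact: upP].
Qed.

Section Spectrum.
Variables (d : Order.disp_t) (A : tbDistrLatticeType d).

Definition prime_pred : {pred set A} := [pred P | `[< prime_filter P >]].

Record spectrum := Spectrum {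
  spectrum_val :> set A; _ : spectrum_val \in prime_pred }.

HB.instance Definition _ := [isSub for spectrum_val].
HB.instance Definition _ := [Choice of spectrum by <:].

Fact spectrum_display : Order.disp_t. Proof. exact: Order.Disp tt tt. Qed.

HB.instance Definition _ :=
  [SubChoice_isSubPOrder of spectrum by <: with spectrum_display].

Definition mk_spectrum (P : set A) (primeP : prime_filter P) : spectrum :=
  @Spectrum P (introT (asboolP (prime_filter P)) primeP).

Implicit Types (P Q : spectrum) (a b : A).

Lemma spectrumP P : prime_filter P.
Proof. by case: P => P /= /asboolP. Qed.

Lemma spectrum_filter P : is_filter P.
Proof. by case: (spectrumP P). Qed.

Lemma spectrum_ideal P : is_ideal (~` P)%classic.
Proof. by case: (spectrumP P). Qed.

Lemma spectrum_leP P Q : reflect (P `<=` Q) (P <= Q).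
Proof. exact: asboolP. Qed.

Lemma spectrum_joinE P a b :
  spectrum_val P (a `|` b) <-> spectrum_val P a \/ spectrum_val P b.
Proof.
split=> [Pab|[]]; last 2 first.
- by apply: filter_le (leUl _ _); exact: spectrum_filter.
- by apply: filter_le (leUr _ _); exact: spectrum_filter.
apply: contrapT => /not_orP[nPa nPb].
exact: (idealU (spectrum_ideal P) nPa nPb).
Qed.

Lemma ex_spectrum_separating (F I : set A) :
    is_filter F -> is_ideal I -> (F `<=` ~` I)%classic ->
  exists P, F `<=` P /\ (P `<=` ~` I)%classic.
Proof.
move=> filF idI FI.
have [P [primeP FP PI _]] := ex_prime_filter_avoiding filF idI FI.
by exists (mk_spectrum primeP).
Qed.

End Spectrum.

Section SpectrumDual.
Variables (d : Order.disp_t) (A : tbDistrLatticeType d).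

Lemma spectrum_setC_prime (P : spectrum A) :
  @prime_filter _ A^d (~` P)%classic.
Proof. by apply/prime_filter_dual; rewrite setCK; exact: spectrumP. Qed.

Definition spectrum_dual (P : spectrum A) : spectrum A^d :=
  mk_spectrum (spectrum_setC_prime P).

Definition spectrum_undual (P : spectrum A^d) : spectrum A :=
  mk_spectrum ((prime_filter_dual _).1 (spectrumP P)).

Lemma spectrum_undual_le (P : spectrum A^d) (Q : spectrum A) :
  (spectrum_undual P <= Q) = (spectrum_dual Q <= P).
Proof. by apply/spectrum_leP/spectrum_leP=> /subsetC; rewrite setCK. Qed.

Lemma le_spectrum_undual (P : spectrum A^d) (Q : spectrum A) :
  (Q <= spectrum_undual P) = (P <= spectrum_dual Q).
Proof. by apply/spectrum_leP/spectrum_leP=> /subsetC; rewrite setCK. Qed.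

End SpectrumDual.

Definition dual_source (s : modsym) : modsym :=
  match s with BoxP => DiaM | BoxM => DiaP | DiaP => BoxM | DiaM => BoxP end.

Definition dual_target (s : modsym) : modsym :=
  match s with BoxP => BoxM | BoxM => BoxP | DiaP => DiaM | DiaM => DiaP end.

Section CanonicalRelation.
Variables A B : Type.
Implicit Types (P : set A) (Q : set B).

Definition canonical_rel (s : modsym) (f : B -> A) P Q : Prop :=
  match s with
  | BoxP => forall b, P (f b) -> Q b
  | BoxM => forall b, P (f b) -> ~ Q b
  | DiaP => forall b, Q b -> P (f b)
  | DiaM => forall b, ~ Q b -> P (f b)
  end.

Lemma canonical_rel_setCl s f P Q :
  canonical_rel s f (~` P)%classic Q <-> canonical_rel (dual_source s) f P Q.
Proof.
case: s; split=> + b => /(_ b); rewrite /setC /=;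
  have [[?|?] [?|?]] := (pselect (P (f b)), pselect (Q b)); tauto.
Qed.

Lemma canonical_rel_setCr s f P Q :
  canonical_rel s f P (~` Q)%classic <-> canonical_rel (dual_target s) f P Q.
Proof.
case: s; split=> + b => /(_ b); rewrite /setC /=;
  have [[?|?] [?|?]] := (pselect (P (f b)), pselect (Q b)); tauto.
Qed.

End CanonicalRelation.

Section MeetMap.
Variables (dA dB : Order.disp_t).
Variables (A : tbDistrLatticeType dA) (B : tbDistrLatticeType dB).

Definition meet_map (f : B -> A) : Prop :=
  (forall a b, f (a `&` b) = f a `&` f b) /\ f \top = \top.

Definition maximal_predecessor (f : B -> A) (P : spectrum A) (Q : spectrum B) :
    Prop :=
  canonical_rel BoxP f P Q /\
  (forall x, ~ spectrum_val P x ->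
    exists y b, [/\ spectrum_val P y, ~ spectrum_val Q b & x `&` y <= f b]).

Variable f : B -> A.
Hypothesis fM : meet_map f.

Lemma meet_map_le : {homo f : a b / a <= b}.
Proof. by move=> a b /meet_idPl ab; apply/meet_idPl; rewrite -fM.1 ab. Qed.

Lemma filter_preimage (P : set A) : is_filter P -> is_filter (f @^-1` P).
Proof.
move=> filP; split=> [|a b Pa Pb|a b ab Pa] /=.
- by rewrite fM.2; exact: filterT.
- by rewrite fM.1; exact: filterI.
- exact: (filter_le filP (meet_map_le ab) Pa).
Qed.

Lemma ex_spectrum_successor (P : spectrum A) b :
    ~ spectrum_val P (f b) ->
  exists2 Q : spectrum B, canonical_rel BoxP f P Q & ~ spectrum_val Q b.
Proof.
move=> nPb; have filP := spectrum_filter P.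
have [|Q [PQ Qb]] :=
  ex_spectrum_separating (filter_preimage filP) (principal_ideal b).
  move=> x /= Px xb; apply: nPb.
  exact: (filter_le filP (meet_map_le xb) Px).
by exists Q => // /Qb; apply; exact: lexx.
Qed.

Lemma ex_maximal_predecessor (P : spectrum A) (Q : spectrum B) :
    canonical_rel BoxP f P Q ->
  exists2 P' : spectrum A, P <= P' & maximal_predecessor f P' Q.
Proof.
move=> PQ.
have [|P' [primeP' PP' P'I notinP']] := ex_prime_filter_avoiding
    (spectrum_filter P) (ideal_lower_image meet_map_le (spectrum_ideal Q)).
  move=> x Px [b nQb xb]; apply/nQb/PQ.
  exact: filter_le (spectrum_filter P) _ _ xb Px.
exists (mk_spectrum primeP'); first exact/spectrum_leP.
split=> [b P'b|x /notinP'[y P'y [b nQb xyb]]]; last by exists y, b.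
by apply: contrapT => nQb; apply: P'I P'b _; exists b.
Qed.

End MeetMap.

Section Superfluous.
Variables (d : Order.disp_t) (B : tbDistrLatticeType d).
Implicit Types (N : set B).

Definition superfluous N : set B :=
  [set b | forall x, N (b `|` x) -> N x].

Lemma superfluous_ideal N : is_filter N -> is_ideal (superfluous N).
Proof.
move=> filN; split=> [x|a b Na Nb x|a b ab Nb x Nax].
- by rewrite join0x.
- by rewrite -joinA => /Na /Nb.
- by apply: Nb; apply: filter_le Nax => //; exact: leU2.
Qed.

Lemma ex_spectrum_avoiding_superfluous N :
    is_filter N -> ~ N \bot ->
  exists Q : spectrum B, N `<=` Q /\ (Q `<=` ~` superfluous N)%classic.
Proof.
move=> filN N0; apply: ex_spectrum_separating (superfluous_ideal filN) _ => //.
by move=> x Nx; move/(_ \bot); rewrite joinx0 => /(_ Nx).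
Qed.

End Superfluous.

Section Refinement.
Variables (dA dB : Order.disp_t).
Variables (A : tbDistrLatticeType dA) (B : tbDistrLatticeType dB).

(* The laws labelled ([BoxP], t), where [f] is the [BoxP]-modality; those with
   another first label arise by dualizing [A] or [B]. *)
Definition companion (t : modsym) (f g : B -> A) : Prop :=
  match t with
  | BoxP => g = f
  | BoxM => forall a b, g a `&` f (a `|` b) <= f b
  | DiaP => forall a b c, g b `&` c <= f a -> f (a `|` b) `&` c <= f a
  | DiaM => (forall a b, g (a `&` b) = g a `|` g b) /\
            (forall a c, g a `&` c <= f a -> c <= f a)
  end.

Section Thickening.
Variables (f : B -> A) (P : spectrum A) (Q : spectrum B).
Hypothesis fM : meet_map f.
Hypothesis maxP : maximal_predecessor f P Q.

(* A prime filter [Q'] below [Q] to which [P] is [BoxP]-related must contain the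
   thickening: it contains [x `|` b] but not [b]. *)
Definition thickening : set B :=
  [set x | exists2 b, ~ spectrum_val Q b & spectrum_val P (f (x `|` b))].

Lemma thickening_sub : thickening `<=` Q.
Proof. by move=> x [b nQb /maxP.1/spectrum_joinE[]]. Qed.

Lemma preimage_sub_thickening : f @^-1` P `<=` thickening.
Proof.
move=> x Px; exists \bot; first exact: ideal0 (spectrum_ideal Q).
by rewrite joinx0.
Qed.

Lemma thickening_filter : is_filter thickening.
Proof.
have [filP idQ] := (spectrum_filter P, spectrum_ideal Q).
split=> [|x y [a nQa Pxa] [b nQb Pyb]|x y xy [b nQb Pxb]].
- by apply: preimage_sub_thickening => /=; rewrite fM.2; exact: filterT.
- exists (a `|` b); first exact: (idealU idQ nQa nQb).
  apply: (filter_le filP) (filterI filP Pxa Pyb).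
  by rewrite -fM.1 meet_map_le // joinIl leI2 // leU2 // ?leUl ?leUr.
- by exists b => //; apply: (filter_le filP) Pxb; rewrite meet_map_le ?leU2.
Qed.

Lemma notin_superfluous b : ~ spectrum_val Q b -> superfluous thickening b.
Proof.
move=> nQb x [c nQc Pbxc]; exists (b `|` c).
  exact: (idealU (spectrum_ideal Q) nQb nQc).
by rewrite joinCA joinA.
Qed.

Lemma companion_BoxM_superfluous g b :
  companion BoxM f g -> spectrum_val P (g b) -> superfluous thickening b.
Proof.
move=> fg Pgb x [c nQc Pbxc]; exists c => //.
have filP := spectrum_filter P; apply: (filter_le filP) (filterI filP Pgb Pbxc).
by rewrite -joinA; exact: fg.
Qed.

Lemma companion_DiaP_superfluous g b :
  companion DiaP f g -> ~ spectrum_val P (g b) -> superfluous thickening b.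
Proof.
move=> fg /maxP.2[y [c [Py nQc gbyc]]] x [c' nQc' Pbxc'].
exists (c' `|` c); first exact: (idealU (spectrum_ideal Q) nQc' nQc).
have filP := spectrum_filter P.
have /fg gby : g b `&` y <= f (x `|` (c' `|` c)).
  by apply: le_trans gbyc _; rewrite meet_map_le // joinA leUr.
apply: (filter_le filP gby); apply: (filterI filP) Py.
apply: (filter_le filP) Pbxc'; apply: (meet_map_le fM).
by rewrite -joinA joinC leU2 // joinA leUl.
Qed.

Lemma companion_DiaM_thickening g b :
  companion DiaM f g -> ~ spectrum_val P (g b) -> thickening b.
Proof.
move=> [gI fg] /maxP.2[y [c [Py nQc gbyc]]]; exists c => //.
apply: (filter_le (spectrum_filter P) _ Py); apply: fg.
apply: (@le_trans _ _ (f c)); last by rewrite meet_map_le ?leUr.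
apply: le_trans gbyc; rewrite leI2 //; apply/join_idPl.
by rewrite -gI; congr g; apply/meet_idPl; exact: leUl.
Qed.

Lemma companion_canonical_rel (Q' : spectrum B) t g :
    thickening `<=` Q' -> (Q' `<=` ~` superfluous thickening)%classic ->
  companion t f g -> canonical_rel t g P Q'.
Proof.
move=> NQ' Q'N; case: t => fg b.
- by rewrite fg => Pb; apply/NQ'/preimage_sub_thickening.
- by move=> Pgb /Q'N; apply; exact: companion_BoxM_superfluous Pgb.
- move=> Q'b; apply: contrapT => nPgb.
  by apply: Q'N Q'b _; exact: companion_DiaP_superfluous nPgb.
- move=> nQ'b; apply: contrapT => nPgb.
  by apply/nQ'b/NQ'; exact: companion_DiaM_thickening nPgb.
Qed.

End Thickening.

Lemma ex_companion_refinement f (P : spectrum A) (Q : spectrum B) :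
    meet_map f -> canonical_rel BoxP f P Q ->
  exists P' Q', [/\ P <= P', Q' <= Q &
    forall t g, companion t f g -> canonical_rel t g P' Q'].
Proof.
move=> fM /(ex_maximal_predecessor fM)[P' PP' maxP'].
have N0 : ~ thickening f P' Q \bot.
  by move=> /(thickening_sub maxP'); exact: ideal0 (spectrum_ideal Q).
have [Q' [NQ' Q'N]] :=
  ex_spectrum_avoiding_superfluous (thickening_filter P' Q fM) N0.
exists P', Q'; split=> // [|t g fg]; last first.
  exact: (companion_canonical_rel fM maxP' NQ' Q'N fg).
apply/spectrum_leP => b Q'b; apply: contrapT => nQb.
exact: Q'N Q'b (notin_superfluous nQb).
Qed.

End Refinement.

Section Residual.
Variables (d : Order.disp_t) (A : tbDistrLatticeType d) (r : A -> A -> A).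
Hypothesis rP : forall x y z : A, x `&` y <= z <-> y <= r x z.

Lemma residual_meet_map a : meet_map (r a).
Proof.
have r_le x y : x <= y -> r a x <= r a y.
  by move=> xy; apply/rP; apply: le_trans xy; exact/rP.
split=> [x y|]; apply: le_anti; last by rewrite lex1 (rP a \top \top).1 ?lex1.
rewrite lexI !r_le ?leIl ?leIr //=; apply/(rP a); rewrite lexI.
by apply/andP; split; apply/(rP a); rewrite ?leIl ?leIr.
Qed.

(* A successor of [P] along the meet map [r a] contains [P] and [a], because
   [x <= r a x] and [r a a = \top]. *)
Lemma ex_spectrum_residual (P : spectrum A) a b :
    ~ spectrum_val P (r a b) ->
  exists Q : spectrum A, [/\ P <= Q, spectrum_val Q a & ~ spectrum_val Q b].
Proof.
move=> /(ex_spectrum_successor (residual_meet_map a))[Q PQ nQb].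
have filP := spectrum_filter P; exists Q; split=> //.
  apply/spectrum_leP => x Px; apply: PQ.
  by apply: (filter_le filP) Px; apply/rP; exact: leIr.
apply: PQ; apply: (filter_le filP) (filterT filP); apply/rP; exact: leIl.
Qed.

End Residual.

Section CanonicalEmbedding.
Variables (d : Order.disp_t) (A : tbDistrLatticeType d).
Implicit Types (P Q : spectrum A) (f g : A -> A).

Lemma canonical_relP s f :
  sym_relation s (fun P Q : spectrum A => canonical_rel s f P Q).
Proof.
case: s => P Q [Q' [P' /spectrum_leP PP' P'Q'] /spectrum_leP QQ'] a /=.
- by move=> /PP' /P'Q' /QQ'.
- by move=> /PP' /P'Q' + /QQ'.
- by move=> /QQ' /P'Q' /PP'.
- by move=> nQa; apply/PP'/P'Q' => /QQ'.
Qed.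

Definition oriented_companion (s t : modsym) f g : Prop :=
  match s with
  | BoxP => @companion _ _ A A t f g
  | BoxM => @companion _ _ A A^d (dual_target t) f g
  | DiaP => @companion _ _ A^d A^d (dual_source (dual_target t)) f g
  | DiaM => @companion _ _ A^d A (dual_source t) f g
  end.

Lemma canonical_refinement s f P Q :
    modal_identities s f -> canonical_rel s f P Q ->
  sym_closure s (fun P' Q' : spectrum A =>
    forall t g, oriented_companion s t f g -> canonical_rel t g P' Q') P Q.
Proof.
case: s => fM PQ.
- have [P' [Q' [PP' Q'Q P'Q']]] := ex_companion_refinement fM PQ.
  by exists Q' => //; exists P'.
- have [P' [Q' [PP' Q'Q P'Q']]] :=
    ex_companion_refinement (B := A^d) (Q := spectrum_dual Q) fM PQ.
  exists (spectrum_undual Q'); last by rewrite /geW le_spectrum_undual.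
  by exists P' => // t g /P'Q' P'Q'g; apply/canonical_rel_setCr.
- have dPQ : canonical_rel BoxP f (~` P)%classic (~` Q)%classic.
    exact/canonical_rel_setCl/canonical_rel_setCr.
  have [P' [Q' [PP' Q'Q P'Q']]] :=
    ex_companion_refinement (A := A^d) (B := A^d)
      (P := spectrum_dual P) (Q := spectrum_dual Q) fM dPQ.
  exists (spectrum_undual Q'); last by rewrite /geW le_spectrum_undual.
  exists (spectrum_undual P'); first by rewrite /geW spectrum_undual_le.
  move=> t g /P'Q' P'Q'g.
  by apply/canonical_rel_setCr/canonical_rel_setCl.
- have dPQ := (canonical_rel_setCl BoxP f P Q).2 PQ.
  have [P' [Q' [PP' Q'Q P'Q']]] :=
    ex_companion_refinement (A := A^d) (P := spectrum_dual P) fM dPQ.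
  exists Q' => //.
  exists (spectrum_undual P'); first by rewrite /geW spectrum_undual_le.
  by move=> t g /P'Q' P'Q'g; apply/canonical_rel_setCl.
Qed.

Definition eta_set (a : A) : set (spectrum A) := [set P | spectrum_val P a].

Lemma eta_upset a : is_upset (eta_set a).
Proof. by move=> P Q /spectrum_leP; apply. Qed.

Definition eta (a : A) : upset (spectrum A) := mk_upset (@eta_upset a).

Lemma eta_inj : injective eta.
Proof.
suff eta_le a b : eta a = eta b -> a <= b.
  by move=> a b eta_ab; apply: le_anti; rewrite !eta_le.
move=> eta_ab; apply: contrapT => nab.
have [|P [aP Pb]] :=
  ex_spectrum_separating (principal_filter a) (principal_ideal b).
  by move=> x ax xb; apply: nab; exact: le_trans xb.
have : upset_val (eta b) P by rewrite -eta_ab; exact: aP (lexx a).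
by move/Pb; apply; exact: lexx.
Qed.

Lemma etaT : eta \top = \top.
Proof.
apply: upset_eqE => P; rewrite upset_topE; split=> // _.
exact: filterT (spectrum_filter P).
Qed.

Lemma eta0 : eta \bot = \bot.
Proof.
apply: upset_eqE => P; rewrite upset_botE; split=> //.
exact: ideal0 (spectrum_ideal P).
Qed.

Lemma etaI a b : eta (a `&` b) = eta a `&` eta b.
Proof.
apply: upset_eqE => P; rewrite upset_meetE; have filP := spectrum_filter P.
split=> [Pab|[Pa Pb]]; last exact: (filterI filP Pa Pb).
split; first exact: (filter_le filP (leIl a b)).
exact: (filter_le filP (leIr b a)).
Qed.

Lemma etaU a b : eta (a `|` b) = eta a `|` eta b.
Proof.
apply: upset_eqE => P; rewrite upset_joinE; exact: spectrum_joinE.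
Qed.

Lemma eta_sym_op s f a :
  modal_identities s f -> eta (f a) = sym_op (@canonical_relP s f) (eta a).
Proof.
move=> fM; apply: upset_eqE => P; case: s fM => fM; split.
- by move=> Pfa Q; exact.
- apply: contraPP => /(ex_spectrum_successor fM)[Q PQ nQa] /(_ Q PQ).
  exact: nQa.
- by move=> Pfa Q; exact.
- apply: contraPP => /(ex_spectrum_successor (B := A^d) fM)[Q PQ nQa].
  move=> /(_ (spectrum_undual Q)); apply; last exact: nQa.
  exact/canonical_rel_setCr.
- move=> Pfa; have nnPfa : ~ ~ spectrum_val P (f a) by [].
  have [Q /canonical_rel_setCl PQ nQa] :=
    ex_spectrum_successor (A := A^d) (B := A^d) fM (P := spectrum_dual P) nnPfa.
  exists (spectrum_undual Q); first exact: nQa.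
  exact/canonical_rel_setCr.
- by move=> [Q Qa]; exact.
- move=> Pfa; have nnPfa : ~ ~ spectrum_val P (f a) by [].
  have [Q /canonical_rel_setCl PQ nQa] :=
    ex_spectrum_successor (A := A^d) fM (P := spectrum_dual P) nnPfa.
  exists Q; first exact: contrapT nQa.
  exact: PQ.
- by move=> [Q Qa]; exact.
Qed.

Lemma eta_imp (r : A -> A -> A) a b :
    (forall x y z, x `&` y <= z <-> y <= r x z) ->
  eta (r a b) = upset_imp (eta a) (eta b).
Proof.
move=> rP; apply: upset_eqE => P; split=> [Prab Q /spectrum_leP PQ Qa|].
  have filQ := spectrum_filter Q.
  by apply: (filter_le filQ) (filterI filQ Qa (PQ _ Prab)); exact/rP.
apply: contraPP => /(ex_spectrum_residual rP)[Q [PQ Qa nQb]] /(_ Q PQ Qa).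
exact: nQb.
Qed.

Lemma eta_coimp (r : A -> A -> A) a b :
    (forall x y z, x <= y `|` z <-> r x y <= z) ->
  eta (r a b) = upset_coimp (eta a) (eta b).
Proof.
move=> rP; apply: upset_eqE => P; split=> [Prab|[Q [/spectrum_leP QP Qa nQb]]].
  have nnPrab : ~ ~ spectrum_val P (r a b) by [].
  have [Q [PQ Qb nQa]] := ex_spectrum_residual (A := A^d)
    (fun x y z => rP z x y) (P := spectrum_dual P) nnPrab.
  exists (spectrum_undual Q); split=> //.
  by rewrite spectrum_undual_le.
have /spectrum_joinE[//|/QP//] : spectrum_val Q (b `|` r a b).
by apply: (filter_le (spectrum_filter Q)) Qa; exact/rP.
Qed.

End CanonicalEmbedding.

Section SymClosure.
Variables (d : Order.disp_t) (W : porderType d).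
Implicit Types (R S : W -> W -> Prop) (x y : W).

Lemma sub_sym_closure s R x y : R x y -> sym_closure s R x y.
Proof.
by case: s => Rxy; exists y => //; try exists x => //; exact: lexx.
Qed.

Lemma sym_closure_mono s R S x y :
  (forall x y, R x y -> S x y) -> sym_closure s R x y -> sym_closure s S x y.
Proof.
move=> RS; case: s => /= -[y' [x' xx' /RS Sxy] yy'];
  by exists y' => //; exists x'.
Qed.

End SymClosure.

Section CanonicalFrame.
Variables (L : {pred modsym}) (e : expansion) (A : modalAlgebra L e).

Definition canonical_frame : frame L :=
  @Frame L spectrum_display (spectrum A)
    (fun s sL P Q => canonical_rel s (mop sL) P Q)
    (fun s sL => @canonical_relP _ A s (mop sL)).

Lemma unimodal_oriented_companion s t (sL : s \in L) (tL : t \in L) :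
  unimodal A -> oriented_companion s t (@mop L e A s sL) (mop tL).
Proof.
move=> uA; have tM := mopP A tL.
case: s t sL tL tM => -[] sL tL tM /=.
- by congr mop; exact: bool_irrelevance.
- exact: uni_BoxP_BoxM.
- exact: uni_BoxP_DiaP.
- by split; [exact: tM.1|exact: uni_BoxP_DiaM].
- exact: uni_BoxM_BoxP.
- by congr mop; exact: bool_irrelevance.
- by split; [exact: tM.1|exact: uni_BoxM_DiaP].
- exact: uni_BoxM_DiaM.
- exact: uni_DiaP_BoxP.
- by split; [exact: tM.1|exact: uni_DiaP_BoxM].
- by congr mop; exact: bool_irrelevance.
- by move=> a b; have := uni_DiaP_DiaM uA sL tL a b; rewrite joinC.
- by split; [exact: tM.1|exact: uni_DiaM_BoxP].
- exact: uni_DiaM_BoxM.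
- by move=> a b; have := uni_DiaM_DiaP uA sL tL a b; rewrite joinC.
- by congr mop; exact: bool_irrelevance.
Qed.

Lemma canonical_frame_unimodal : unimodal A -> unimodal_frame canonical_frame.
Proof.
move=> uA; exists (fun P Q : spectrum A => forall t (tL : t \in L),
  canonical_rel t (mop tL : A -> A) P Q) => s sL P Q; split=> PQ.
  apply: sym_closure_mono (canonical_refinement (mopP A sL) PQ).
  by move=> P' Q' P'Q' t tL; apply: P'Q'; exact: unimodal_oriented_companion.
by apply: canonical_relP; apply: sym_closure_mono PQ => P' Q'; exact.
Qed.

Lemma eval_canonical v (t : term L e) :
  eval (A := complex_algebra canonical_frame e) (fun n => eta (v n)) t =
  eta (eval (A := A) v t).
Proof.
elim: t => [n|||t IHt u IHu|t IHt u IHu|s sL t IHt|himp t IHt u IHu|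
          hcoimp t IHt u IHu] /=.
- by [].
- by rewrite etaT.
- by rewrite eta0.
- by rewrite IHt IHu etaI.
- by rewrite IHt IHu etaU.
- by rewrite IHt (eta_sym_op _ (mopP A sL)).
- by rewrite IHt IHu (eta_imp _ _ (@impP _ _ A himp)).
- by rewrite IHt IHu (eta_coimp _ _ (@coimpP _ _ A hcoimp)).
Qed.

Lemma holds_canonical v (phi : qf_formula L e) :
  holds (A := complex_algebra canonical_frame e) (fun n => eta (v n)) phi <->
  holds (A := A) v phi.
Proof.
elim: phi => [t u||f IHf|f IHf g IHg|f IHf g IHg|f IHf g IHg] /=.
- by rewrite !eval_canonical; split=> [/eta_inj|->].
all: tauto.
Qed.

End CanonicalFrame.

Section PointwiseLaws.
Variables (d : Order.disp_t) (W : porderType d) (R : W -> W -> Prop).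
Implicit Types (a b : set W) (x : W).

Lemma BoxP_or_DiaM a x : sym_op_set BoxP R a x \/ sym_op_set DiaM R a x.
Proof.
have [xa|nxa] := pselect (sym_op_set DiaM R a x); [by right|left=> z Rxz].
by apply: contrapT => naz; apply: nxa; exists z.
Qed.

Lemma BoxM_or_DiaP a x : sym_op_set BoxM R a x \/ sym_op_set DiaP R a x.
Proof.
have [xa|nxa] := pselect (sym_op_set DiaP R a x); [by right|left=> z Rxz az].
by apply: nxa; exists z.
Qed.

Lemma BoxP_setU a b x :
  sym_op_set BoxP R (a `|` b)%classic x ->
  sym_op_set BoxP R a x \/ sym_op_set DiaP R b x.
Proof.
move=> xab; have [xb|xb] := BoxM_or_DiaP b x; [left=> z Rxz|by right].
by have [//|/(xb z Rxz)] := xab z Rxz.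
Qed.

Lemma BoxM_setI a b x :
  sym_op_set BoxM R (a `&` b)%classic x ->
  sym_op_set BoxM R a x \/ sym_op_set DiaM R b x.
Proof.
move=> xab; have [xb|xb] := BoxP_or_DiaM b x; [left=> z Rxz az|by right].
by apply: (xab z Rxz); split=> //; exact: xb.
Qed.

Lemma DiaP_setI a b x :
  sym_op_set DiaP R a x -> sym_op_set BoxP R b x ->
  sym_op_set DiaP R (a `&` b)%classic x.
Proof. by move=> [z az Rxz] xb; exists z => //; split=> //; exact: xb. Qed.

Lemma DiaM_setU a b x :
  sym_op_set DiaM R a x -> sym_op_set BoxM R b x ->
  sym_op_set DiaM R (a `|` b)%classic x.
Proof. by move=> [z naz Rxz] xb; exists z => // -[//|]; exact: xb. Qed.

End PointwiseLaws.

Definition is_box (s : modsym) : bool :=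
  match s with BoxP | BoxM => true | DiaP | DiaM => false end.

Section ComplexAlgebra.
Variables (L : {pred modsym}) (e : expansion) (F : frame L).
Variable R : F -> F -> Prop.
Hypothesis FR : forall s (sL : s \in L) (x y : F),
  fr_rel sL x y <-> sym_closure s R x y.
Local Notation C := (complex_algebra F e).

Lemma le_mop_box s (sL : s \in L) (a c : C) : is_box s ->
  c <= mop sL a <-> (forall x, upset_val c x -> sym_op_set s R a x).
Proof.
rewrite upset_leE; case: s sL => // sL _; split=> cR x cx z.
- by move=> Rxz; apply: (cR x cx); apply/FR/sub_sym_closure.
- move=> /FR[z' [y xy yz'] z'z]; apply: upsetP z'z _.
  exact: cR (upsetP xy cx) _ yz'.
- by move=> Rxz; apply: (cR x cx); apply/FR/sub_sym_closure.
- move=> /FR[z' [y xy yz'] z'z] az; apply: cR (upsetP xy cx) _ yz' _.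
  exact: upsetP z'z az.
Qed.

Lemma mop_dia_le s (sL : s \in L) (a c : C) : ~~ is_box s ->
  mop sL a <= c <-> (forall x, sym_op_set s R a x -> upset_val c x).
Proof.
rewrite upset_leE; case: s sL => // sL _; split=> Rc x [z az].
- by move=> Rxz; apply: Rc; exists z => //; apply/FR/sub_sym_closure.
- move=> /FR[z' [y yx yz'] zz']; apply: upsetP yx (Rc _ _).
  by exists z' => //; exact: upsetP zz' az.
- by move=> Rxz; apply: Rc; exists z => //; apply/FR/sub_sym_closure.
- move=> /FR[z' [y yx yz'] z'z]; apply: upsetP yx (Rc _ _).
  by exists z' => // /(upsetP z'z).
Qed.

Lemma mop_box_sub s (sL : s \in L) (a : C) x :
  upset_val (mop sL a) x -> is_box s -> sym_op_set s R a x.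
Proof.
move=> xa box_s; exact: ((le_mop_box sL a _ box_s).1 (lexx (mop sL a)) x xa).
Qed.

Lemma sub_mop_dia s (sL : s \in L) (a : C) x :
  ~~ is_box s -> sym_op_set s R a x -> upset_val (mop sL a) x.
Proof.
move=> dia_s; exact: ((mop_dia_le sL a _ dia_s).1 (lexx (mop sL a)) x).
Qed.

Lemma meet_le_mop_box s t (sL : s \in L) (tL : t \in L) (a b u c : C) :
    is_box s -> ~~ is_box t ->
    (forall x, upset_val u x -> sym_op_set s R a x \/ sym_op_set t R b x) ->
  mop tL b `&` c <= mop sL a -> u `&` c <= mop sL a.
Proof.
move=> box_s dia_t u_cover /upset_leE bca; apply/le_mop_box => //.
move=> x /upset_meetE[/u_cover[//|xb] cx]; apply: (mop_box_sub _ box_s).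
by apply/bca/upset_meetE; split=> //; exact: sub_mop_dia.
Qed.

Lemma mop_dia_le_join s t (sL : s \in L) (tL : t \in L) (a b u c : C) :
    ~~ is_box s -> is_box t ->
    (forall x, sym_op_set s R a x -> sym_op_set t R b x -> upset_val u x) ->
  mop sL a <= mop tL b `|` c -> mop sL a <= u `|` c.
Proof.
move=> dia_s box_t u_above /upset_leE abc; apply/mop_dia_le => //.
move=> x xa; apply/upset_joinE.
have /abc/upset_joinE[xb|] : upset_val (mop sL a) x.
- exact: sub_mop_dia.
- by left; apply: u_above xa _; exact: mop_box_sub xb _.
- by right.
Qed.

Lemma complex_algebra_unimodal : unimodal C.
Proof.
split.
- move=> bp bm a b; rewrite joinC; apply/le_mop_box => // x.
  move=> /upset_meetE[/mop_box_sub xa /mop_box_sub-/(_ isT)/BoxP_setU[//|]].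
  by move=> [z az Rxz]; case: (xa isT z Rxz).
- move=> bm bp a b; rewrite [X in mop bm X]meetC; apply/le_mop_box => // x.
  move=> /upset_meetE[/mop_box_sub xa /mop_box_sub-/(_ isT)/BoxM_setI[//|]].
  by move=> [z naz Rxz]; case: naz; exact: xa isT z Rxz.
- move=> dp dm a b; rewrite meetC; apply/mop_dia_le => // x xb.
  apply/upset_joinE; have [xa|xa] := BoxP_or_DiaM R a x; [left|right].
    by apply: sub_mop_dia => //; exact: DiaP_setI.
  exact: sub_mop_dia.
- move=> dm dp a b; rewrite [X in mop dm X `|` _]joinC.
  apply/mop_dia_le => // x xb.
  apply/upset_joinE; have [xa|xa] := BoxM_or_DiaP R a x; [left|right].
    by apply: sub_mop_dia => //; exact: DiaM_setU.
  exact: sub_mop_dia.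
- move=> bp dm a c; rewrite -[X in _ -> X <= _]meet1x.
  by apply: meet_le_mop_box => // x _; exact: BoxP_or_DiaM.
- move=> bm dp a c; rewrite -[X in _ -> X <= _]meet1x.
  by apply: meet_le_mop_box => // x _; exact: BoxM_or_DiaP.
- move=> dp bm a c; rewrite -[X in _ -> _ <= X]join0x.
  by apply: mop_dia_le_join => // x [z az Rxz] /(_ z Rxz).
- move=> dm bp a c; rewrite -[X in _ -> _ <= X]join0x.
  by apply: mop_dia_le_join => // x [z naz Rxz] /(_ z Rxz).
- move=> bp dp a b c; apply: meet_le_mop_box => // x xab.
  exact/BoxP_setU/(mop_box_sub xab).
- move=> bm dm a b c; apply: meet_le_mop_box => // x xab.
  exact/BoxM_setI/(mop_box_sub xab).
- move=> dp bp a b c; apply: mop_dia_le_join => // x xa xb.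
  by apply: sub_mop_dia => //; exact: DiaP_setI.
- move=> dm bm a b c; apply: mop_dia_le_join => // x xa xb.
  by apply: sub_mop_dia => //; exact: DiaM_setU.
Qed.

End ComplexAlgebra.

Section UnimodalAxioms.
Variables (L : {pred modsym}) (e : expansion).

Definition FLe (t u : term L e) : qf_formula L e := FEq (TMeet t u) t.

Definition unimodal_axiom (s t : modsym) (sL : s \in L) (tL : t \in L) :
    qf_formula L e :=
  let a := Var L e 0 in let b := Var L e 1 in let c := Var L e 2 in
  match s, t with
  | BoxP, BoxM => FLe (TMeet (TMod tL a) (TMod sL (TJoin a b))) (TMod sL b)
  | BoxM, BoxP => FLe (TMeet (TMod tL a) (TMod sL (TMeet a b))) (TMod sL b)
  | DiaP, DiaM => FLe (TMod sL b) (TJoin (TMod sL (TMeet a b)) (TMod tL a))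
  | DiaM, DiaP => FLe (TMod sL b) (TJoin (TMod sL (TJoin a b)) (TMod tL a))
  | BoxP, DiaM | BoxM, DiaP =>
      FImplies (FLe (TMeet (TMod tL a) c) (TMod sL a)) (FLe c (TMod sL a))
  | DiaP, BoxM | DiaM, BoxP =>
      FImplies (FLe (TMod sL a) (TJoin (TMod tL a) c)) (FLe (TMod sL a) c)
  | BoxP, DiaP =>
      FImplies (FLe (TMeet (TMod tL b) c) (TMod sL a))
        (FLe (TMeet (TMod sL (TJoin a b)) c) (TMod sL a))
  | BoxM, DiaM =>
      FImplies (FLe (TMeet (TMod tL b) c) (TMod sL a))
        (FLe (TMeet (TMod sL (TMeet a b)) c) (TMod sL a))
  | DiaP, BoxP =>
      FImplies (FLe (TMod sL a) (TJoin (TMod tL b) c))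
        (FLe (TMod sL a) (TJoin (TMod sL (TMeet a b)) c))
  | DiaM, BoxM =>
      FImplies (FLe (TMod sL a) (TJoin (TMod tL b) c))
        (FLe (TMod sL a) (TJoin (TMod sL (TJoin a b)) c))
  | BoxP, BoxP | BoxM, BoxM | DiaP, DiaP | DiaM, DiaM => FNot (FFalse L e)
  end.

Lemma unimodalP (A : modalAlgebra L e) :
  unimodal A <->
  forall s t (sL : s \in L) (tL : t \in L), satisfies A (unimodal_axiom sL tL).
Proof.
split=> [uA [] [] sL tL v|axA] //=.
- exact/meet_idPl/uni_BoxP_BoxM.
- by move=> /meet_idPl premise; exact/meet_idPl/(uni_BoxP_DiaP uA).
- by move=> /meet_idPl premise; exact/meet_idPl/(uni_BoxP_DiaM uA).
- exact/meet_idPl/uni_BoxM_BoxP.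
- by move=> /meet_idPl premise; exact/meet_idPl/(uni_BoxM_DiaP uA).
- by move=> /meet_idPl premise; exact/meet_idPl/(uni_BoxM_DiaM uA).
- by move=> /meet_idPl premise; exact/meet_idPl/(uni_DiaP_BoxP uA).
- by move=> /meet_idPl premise; exact/meet_idPl/(uni_DiaP_BoxM uA premise).
- exact/meet_idPl/uni_DiaP_DiaM.
- by move=> /meet_idPl premise; exact/meet_idPl/(uni_DiaM_BoxP uA premise).
- by move=> /meet_idPl premise; exact/meet_idPl/(uni_DiaM_BoxM uA).
- exact/meet_idPl/uni_DiaM_DiaP.
have {}axA s t (sL : s \in L) (tL : t \in L) (a b c : A) :=
  axA s t sL tL (fun n => nth c [:: a; b] n).
split=> sL tL a.
1-4: by move=> b; exact/meet_idPl/(axA _ _ sL tL a b a).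
1-4: by move=> c /meet_idPl premise; exact/meet_idPl/(axA _ _ sL tL a a c).
all: by move=> b c /meet_idPl premise; exact/meet_idPl/(axA _ _ sL tL a b c).
Qed.

End UnimodalAxioms.

Theorem mainTheorem7 (L : {pred modsym}) (e : expansion)
    (A : modalAlgebra L e) :
  unimodal A <->
  (forall phi : qf_formula L e,
     (forall F : frame L,
        unimodal_frame F -> satisfies (complex_algebra F e) phi) ->
     satisfies A phi).
Proof.
split=> [uA phi valid v|valid].
  by apply/holds_canonical/valid; exact: canonical_frame_unimodal.
apply/unimodalP => s t sL tL; apply: valid => F [R FR].
by apply: (unimodalP _).1; exact: complex_algebra_unimodal FR.
Qed.
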